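(* Let $P=(D,C)$ be a well-formed program of Core Choreographies with $C\neq\mathsf{end}$. Then for every state $s$ there exist an observable label $\lambda$ and a configuration $c'$ such that $(P,s)\xrightarrow{\lambda}c'$.
   Context: Fix types with decidable equality of process names $\mathsf{Pid}$, variables $\mathsf{Var}$, values $\mathsf{Val}$, expressions, Boolean expressions, procedure names $\mathsf{RecVar}$, annotations, and evaluation functions $\mathrm{eval}$ (expression and local state $\mathsf{Var}\to\mathsf{Val}$ to value) and $\mathrm{beval}$ (Boolean expression and local state to Boolean), invariant under extensional equality of local states. Labels: $\mathsf{left},\mathsf{right}$. A state is $s:\mathsf{Pid}\to\mathsf{Var}\to\mathsf{Val}$; $s\equiv s'$ is extensional equality; $s[q,x\mapsto v]$ is update. Interactions $\eta::=p.e\to q.x\mid p\to q[l]$ (processes $\{p,q\}$); choreographies $C::=\eta@a;C\mid\mathsf{if}\ p.b\ \mathsf{then}\ C_1\ \mathsf{else}\ C_2\mid\mathsf{call}\ X\mid\mathsf{rtcall}\ X\ ps\ C\mid\mathsf{end}$, $ps$ a list of processes. $D:\mathsf{RecVar}\to\mathrm{list}(\mathsf{Pid})\times\mathsf{Chor}$, $D\,X=(\mathrm{Vars}\,X,\mathrm{Body}\,X)$; a program is $(D,C)$, a configuration is a pair (program, state). Rich labels $\mathrm{com}(p,v,q,x),\mathrm{sel}(p,q,l),\mathrm{cond}(p),\mathrm{call}(X,p)$ with processes $\{p,q\},\{p,q\},\{p\},\{p\}$. $\langle C,s\rangle\xrightarrow{\rho}_D\langle C',s'\rangle$ is the least relation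 with: $\langle p.e\to q.x@a;C,s\rangle\xrightarrow{\mathrm{com}(p,v,q,x)}\langle C,s'\rangle$ if $v=\mathrm{eval}(e,s\,p)$, $s'\equiv s[q,x\mapsto v]$; $\langle p\to q[l]@a;C,s\rangle\xrightarrow{\mathrm{sel}(p,q,l)}\langle C,s'\rangle$ if $s\equiv s'$; $\langle\mathsf{if}\ p.b\ \mathsf{then}\ C_1\ \mathsf{else}\ C_2,s\rangle\xrightarrow{\mathrm{cond}(p)}\langle C_1,s'\rangle$ (resp. $C_2$) if $\mathrm{beval}(b,s\,p)$ is true (resp. false), $s\equiv s'$; $\langle\eta@a;C,s\rangle\xrightarrow{\rho}\langle\eta@a;C',s'\rangle$ if $\langle C,s\rangle\xrightarrow{\rho}\langle C',s'\rangle$ and processes of $\eta$, $\rho$ are disjoint; $\langle\mathsf{if}\ p.b\ \mathsf{then}\ C_1\ \mathsf{else}\ C_2,s\rangle\xrightarrow{\rho}\langle\mathsf{if}\ p.b\ \mathsf{then}\ C_1'\ \mathsf{else}\ C_2',s'\rangle$ if $p$ not in $\rho$ and $\langle C_i,s\rangle\xrightarrow{\rho}\langle C_i',s'\rangle$, $i=1,2$; $\langle\mathsf{rtcall}\ X\ ps\ C,s\rangle\xrightarrow{\rho}\langle\mathsf{rtcall}\ X\ ps\ C',s'\rangle$ if no process of $\rho$ is in $ps$ and $\langle C,s\rangle\xrightarrow{\rho}\langle C',s'\rangle$; for $s\equiv s'$, $p\in\mathrm{Vars}\,X$: $\langle\mathsf{call}\ X,s\rangle\xrightarrow{\mathrm{call}(X,p)}\langle\mathrm{Body}\,X,s'\rangle$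 if $\#\mathrm{Vars}\,X=1$, and $\langle\mathsf{rtcall}\ X\ (\mathrm{Vars}\,X\setminus p)\ (\mathrm{Body}\,X),s'\rangle$ if $\#\mathrm{Vars}\,X>1$; for $s\equiv s'$, $p\in ps$: $\langle\mathsf{rtcall}\ X\ ps\ C,s\rangle\xrightarrow{\mathrm{call}(X,p)}\langle\mathsf{rtcall}\ X\ (ps\setminus p)\ C,s'\rangle$ if $\#ps>1$ and $\langle C,s'\rangle$ if $\#ps=1$ ($\#$ is list size, $\setminus p$ removes $p$). Observable labels: $\mathrm{forget}(\mathrm{com}(p,v,q,x))=\mathrm{com}(p,v,q)$, $\mathrm{forget}(\mathrm{sel}(p,q,l))=\mathrm{sel}(p,q,l)$, $\mathrm{forget}(\mathrm{cond}(p))=\mathrm{forget}(\mathrm{call}(X,p))=\tau(p)$; $((D,C),s)\xrightarrow{\mathrm{forget}(\rho)}((D,C'),s')$ iff $\langle C,s\rangle\xrightarrow{\rho}_D\langle C',s'\rangle$. Well-formedness of $(D,C)$: $C$ contains no self-interaction ($p.e\to p.x$ or $p\to p[l]$), every $\mathsf{rtcall}\ X\ ps\ C'$ in $C$ has $ps$ nonempty with $ps\subseteq\mathrm{Vars}\,X$; for every $X$, $\mathrm{Body}\,X$ contains no self-interaction and no $\mathsf{rtcall}$, $\mathrm{Vars}\,X$ is nonempty, and every process occurring in $\mathrm{Body}\,X$ (counting, for each $\mathsf{call}\ Y$ in it, the processes of $\mathrm{Vars}\,Y$) is in $\mathrm{Vars}\,X$. *)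

(* Defs.v *)
From mathcomp Require Import all_boot.

Set Implicit Arguments.
Unset Strict Implicit.
Unset Printing Implicit Defensive.

(* The fixed parameters of the language; the components are arbitrary, possibly
   infinite, types with decidable equality. *)
Record signature := Signature {
  Pid : eqType;
  Var : eqType;
  Val : eqType;
  Expr : eqType;
  BExpr : eqType;
  RecVar : eqType;
  Ann : eqType;
  eval : Expr -> (Var -> Val) -> Val;
  beval : BExpr -> (Var -> Val) -> bool;
  eval_ext : forall e (f g : Var -> Val), f =1 g -> eval e f = eval e g;
  beval_ext : forall b (f g : Var -> Val), f =1 g -> beval b f = beval b g }.

Arguments eval {s} _ _.
Arguments beval {s} _ _.

Definition State (S : signature) : Type := Pid S -> Var S -> Val S.

Definition eq_state (S : signature) (s s' : State S) : Prop := s =2 s'.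

Definition update (S : signature)
    (s : State S) (q : Pid S) (x : Var S) (v : Val S) : State S :=
  fun r y => if (r == q) && (y == x) then v else s r y.

Inductive label : Type := lab_left | lab_right.

Inductive Eta (S : signature) : Type :=
| Com (p : Pid S) (e : Expr S) (q : Pid S) (x : Var S)
| Sel (p q : Pid S) (l : label).

Inductive Chor (S : signature) : Type :=
| Interaction (eta : Eta S) (a : Ann S) (C : Chor S)
| Cond (p : Pid S) (b : BExpr S) (C1 C2 : Chor S)
| Call (X : RecVar S)
| RTCall (X : RecVar S) (ps : seq (Pid S)) (C : Chor S)
| End.

Arguments Call {S} X.
Arguments End {S}.

Definition DefSet (S : signature) : Type := RecVar S -> seq (Pid S) * Chor S.

Definition Vars (S : signature) (D : DefSet S) (X : RecVar S) : seq (Pid S) :=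
  (D X).1.

Definition Body (S : signature) (D : DefSet S) (X : RecVar S) : Chor S :=
  (D X).2.

Definition Program (S : signature) : Type := (DefSet S * Chor S)%type.

Definition Configuration (S : signature) : Type := (Program S * State S)%type.

Inductive RichLabel (S : signature) : Type :=
| R_Com (p : Pid S) (v : Val S) (q : Pid S) (x : Var S)
| R_Sel (p q : Pid S) (l : label)
| R_Cond (p : Pid S)
| R_Call (X : RecVar S) (p : Pid S).

Inductive ObsLabel (S : signature) : Type :=
| L_Com (p : Pid S) (v : Val S) (q : Pid S)
| L_Sel (p q : Pid S) (l : label)
| L_Tau (p : Pid S).

Definition forget (S : signature) (rho : RichLabel S) : ObsLabel S :=
  match rho with
  | R_Com p v q _ => L_Com p v q
  | R_Sel p q l => L_Sel p q l
  | R_Cond p => L_Tau p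
  | R_Call _ p => L_Tau p
  end.

Definition eta_procs (S : signature) (eta : Eta S) : seq (Pid S) :=
  match eta with
  | Com p _ q _ => [:: p; q]
  | Sel p q _ => [:: p; q]
  end.

Definition label_procs (S : signature) (rho : RichLabel S) : seq (Pid S) :=
  match rho with
  | R_Com p _ q _ => [:: p; q]
  | R_Sel p q _ => [:: p; q]
  | R_Cond p => [:: p]
  | R_Call _ p => [:: p]
  end.

Definition seq_disjoint (T : eqType) (xs ys : seq T) : bool :=
  ~~ has (mem xs) ys.

(* Lists of processes may have repetitions: [size] counts them, and [rem]
   removes the first occurrence only, so removing an element from a list of
   size greater than one always leaves a nonempty list. *)
Inductive step (S : signature) (D : DefSet S) :
    Chor S -> State S -> RichLabel S -> Chor S -> State S -> Prop :=
| S_Com p e q x a C s s' v :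
    v = eval e (s p) -> eq_state s' (update s q x v) ->
    step D (Interaction (Com p e q x) a C) s (R_Com p v q x) C s'
| S_Sel p q l a C s s' :
    eq_state s s' ->
    step D (Interaction (Sel p q l) a C) s (R_Sel p q l) C s'
| S_Then p b C1 C2 s s' :
    beval b (s p) = true -> eq_state s s' ->
    step D (Cond p b C1 C2) s (R_Cond p) C1 s'
| S_Else p b C1 C2 s s' :
    beval b (s p) = false -> eq_state s s' ->
    step D (Cond p b C1 C2) s (R_Cond p) C2 s'
| S_DelayEta eta a C C' s s' rho :
    seq_disjoint (eta_procs eta) (label_procs rho) ->
    step D C s rho C' s' ->
    step D (Interaction eta a C) s rho (Interaction eta a C') s'
| S_DelayCond p b C1 C2 C1' C2' s s' rho :
    p \notin label_procs rho ->
    step D C1 s rho C1' s' -> step D C2 s rho C2' s' ->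
    step D (Cond p b C1 C2) s rho (Cond p b C1' C2') s'
| S_DelayCall X ps C C' s s' rho :
    seq_disjoint ps (label_procs rho) ->
    step D C s rho C' s' ->
    step D (RTCall X ps C) s rho (RTCall X ps C') s'
| S_CallLocal X p s s' :
    eq_state s s' -> p \in Vars D X -> size (Vars D X) = 1 ->
    step D (Call X) s (R_Call X p) (Body D X) s'
| S_CallStart X p s s' :
    eq_state s s' -> p \in Vars D X -> 1 < size (Vars D X) ->
    step D (Call X) s (R_Call X p)
      (RTCall X (rem p (Vars D X)) (Body D X)) s'
| S_CallEnter X ps p C s s' :
    eq_state s s' -> p \in ps -> 1 < size ps ->
    step D (RTCall X ps C) s (R_Call X p) (RTCall X (rem p ps) C) s'
| S_CallFinish X ps p C s s' :
    eq_state s s' -> p \in ps -> size ps = 1 ->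
    step D (RTCall X ps C) s (R_Call X p) C s'.

Inductive obs_step (S : signature) :
    Configuration S -> ObsLabel S -> Configuration S -> Prop :=
| Obs_Step D C s rho C' s' :
    step D C s rho C' s' ->
    obs_step ((D, C), s) (forget rho) ((D, C'), s').

Definition self_interaction (S : signature) (eta : Eta S) : bool :=
  match eta with
  | Com p _ q _ => p == q
  | Sel p q _ => p == q
  end.

Fixpoint no_self_interaction (S : signature) (C : Chor S) : bool :=
  match C with
  | Interaction eta _ C' => ~~ self_interaction eta && no_self_interaction C'
  | Cond _ _ C1 C2 => no_self_interaction C1 && no_self_interaction C2
  | Call _ => true
  | RTCall _ _ C' => no_self_interaction C'
  | End => true
  end.

Fixpoint rtcalls_ok (S : signature) (D : DefSet S) (C : Chor S) : bool :=
  match C with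
  | Interaction _ _ C' => rtcalls_ok D C'
  | Cond _ _ C1 C2 => rtcalls_ok D C1 && rtcalls_ok D C2
  | Call _ => true
  | RTCall X ps C' =>
      [&& ps != [::], all (fun p => p \in Vars D X) ps & rtcalls_ok D C']
  | End => true
  end.

Fixpoint no_rtcall (S : signature) (C : Chor S) : bool :=
  match C with
  | Interaction _ _ C' => no_rtcall C'
  | Cond _ _ C1 C2 => no_rtcall C1 && no_rtcall C2
  | Call _ => true
  | RTCall _ _ _ => false
  | End => true
  end.

Fixpoint chor_procs (S : signature) (D : DefSet S) (C : Chor S) :
    seq (Pid S) :=
  match C with
  | Interaction eta _ C' => eta_procs eta ++ chor_procs D C'
  | Cond p _ C1 C2 => p :: chor_procs D C1 ++ chor_procs D C2
  | Call Y => Vars D Y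
  | RTCall _ ps C' => ps ++ chor_procs D C'
  | End => [::]
  end.

Definition well_formed_body (S : signature) (D : DefSet S) (X : RecVar S) :
    Prop :=
  [/\ no_self_interaction (Body D X),
      no_rtcall (Body D X),
      Vars D X != [::] &
      {subset chor_procs D (Body D X) <= Vars D X}].

Definition well_formed (S : signature) (P : Program S) : Prop :=
  [/\ no_self_interaction P.2,
      rtcalls_ok P.1 P.2 &
      forall X, well_formed_body P.1 X].

(* Main.v *)
Require Import Defs.
From mathcomp Require Import all_boot.

(* The head constructor of a choreography can always be executed first, so the
   delay rules are not needed. Well-formedness enters only through the
   nonemptiness of process lists: some process can then enter the procedure. *)

(** The first process [p] of [Vars D X] enters. If it is alone, the body starts at once; otherwise a
    runtime call keeps the others waiting. As the rules accept any final state extensionally equal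
    to [s], [s] itself serves. *)
Lemma step_call (S : signature) (D : DefSet S) (X : RecVar S) (s : State S) :
  Vars D X != [::] -> exists rho C', step D (Call X) s rho C' s.
Proof.
case E: (Vars D X) => [//|p ps] _; exists (R_Call X p).
have pX: p \in Vars D X by rewrite E mem_head.
case: ps E => [|q ps] E.
- by exists (Body D X); apply: S_CallLocal => //; rewrite E.
- exists (RTCall X (rem p (Vars D X)) (Body D X)).
  by apply: S_CallStart => //; rewrite E.
Qed.

Lemma step_rtcall (S : signature) (D : DefSet S) (X : RecVar S)
    (ps : seq (Pid S)) (C : Chor S) (s : State S) :
  ps != [::] -> exists rho C', step D (RTCall X ps C) s rho C' s.
Proof.
(* A lone [p] is the last to enter and releases [C]; in a longer list [p] just leaves the queue. *)
case: ps => [//|p [|q ps]] _; exists (R_Call X p).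
- by exists C; apply: S_CallFinish => //; rewrite mem_head.
- exists (RTCall X (rem p [:: p, q & ps]) C).
  by apply: S_CallEnter => //; rewrite mem_head.
Qed.

Lemma step_progress (S : signature) (D : DefSet S) (C : Chor S) (s : State S) :
  well_formed (D, C) -> C <> End -> exists rho C' s', step D C s rho C' s'.
Proof.
move=> [_ /= rtC wfD]; case: C rtC => [eta a C|p b C1 C2|X|X ps C|] //= rtC _.
- case: eta => [p e q x|p q l].
  + exists (R_Com p (eval e (s p)) q x), C, (update s q x (eval e (s p))).
    exact: S_Com.
  + by exists (R_Sel p q l), C, s; apply: S_Sel.
- exists (R_Cond p); case E: (beval b (s p)).
  + by exists C1, s; apply: S_Then.
  + by exists C2, s; apply: S_Else.
(* For [Call X], nonemptiness comes from the definition of [X]; for a runtime call, from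
   [rtcalls_ok]. *)
- have [_ _ X0 _] := wfD X.
  by have [rho [C' st]] := @step_call S D X s X0; exists rho, C', s.
- have /and3P[ps0 _ _] := rtC.
  by have [rho [C' st]] := @step_rtcall S D X ps C s ps0; exists rho, C', s.
Qed.

Theorem mainTheorem3 (S : signature) (D : DefSet S) (C : Chor S)
    (hwf : well_formed (D, C)) (hC : C <> End) :
  forall s : State S, exists (lam : ObsLabel S) (c' : Configuration S),
    obs_step ((D, C), s) lam c'.
Proof.
move=> s; have [rho [C' [s' st]]] := @step_progress S D C s hwf hC.
by exists (forget rho), ((D, C'), s'); apply: Obs_Step.
Qed.
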